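(* Let $A$ be a finite abelian group and $t\geq1$. For $\mathbf{v},\mathbf{w}\in Z_t(A)$, one has $$\widetilde u_{\mathbf{v}}\,\widetilde u_{\mathbf{w}}=\alpha_t(\mathbf{v},\mathbf{w})\,\widetilde u_{\mathbf{v}+\mathbf{w}}.$$ The function $\alpha_t$ is an $\mathrm{Sp}(V_A)$-invariant bicharacter on $Z_t(A)$. Consequently, $$\mathfrak{D}_t(A)\simeq\mathbb{C}_{\alpha_t}[Z_t(A)]^{\mathrm{Sp}(V_A)}$$ as algebras.
   Context: **Setting.** $A$ is a finite abelian group, written additively; $\widehat{A}=\mathrm{Hom}(A,U(1))$; $V_A=A\oplus\widehat{A}$ (written additively). Put $\beta_A((a,\chi),(b,\psi))=\chi(b)$ and $\omega_A(u,v)=\beta_A(u,v)\beta_A(v,u)^{-1}$; $\mathrm{Sp}(V_A)=\{T\in\mathrm{Aut}(V_A):\omega_A(Tu,Tv)=\omega_A(u,v)\ \forall u,v\}$. **Weyl operators and Clifford group.** Let $\mathcal{H}=\mathbb{C}[A]$ with orthonormal basis $|b\rangle$, $b\in A$; for $v=(a,\chi)\in V_A$ let $u_v=W_v$ be the operator $W_v|b\rangle=\chi(b)|a+b\rangle$, so $u_vu_w=\beta_A(v,w)u_{v+w}$. $H(A)=\{zW_v:z\in U(1),v\in V_A\}$ and $C(A)=N_{U(\mathcal{H})}(H(A))/(U(1)\cdot I)$. For $g\in C(A)$ let $U_g$ be a unitary representative; conjugation by $U_g$ has the form $U_gu_vU_g^{-1}=\lambda(v)u_{Tv}$ with $T\in\mathrm{Sp}(V_A)$,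 $\lambda:V_A\to U(1)$. It is known that every $T\in\mathrm{Sp}(V_A)$ arises in this way. **Commutant.** $\mathfrak{D}_t(A)=\{X\in\mathrm{End}_{\mathbb{C}}(\mathcal{H}^{\otimes t}):XU_g^{\otimes t}=U_g^{\otimes t}X\text{ for every }g\in C(A)\}$. **Tuples.** $Z_t(A)=\{(v_1,\dots,v_t)\in V_A^t:v_1+\cdots+v_t=0\}$ with the diagonal $\mathrm{Sp}(V_A)$-action. For $\mathbf{v}=(v_1,\dots,v_t)\in Z_t(A)$: $\kappa_t(\mathbf{v})=\prod_{1\leq i<j\leq t}\beta_A(v_i,v_j)$, $u_{\mathbf{v}}=u_{v_1}\otimes\cdots\otimes u_{v_t}$, $\widetilde u_{\mathbf{v}}=\kappa_t(\mathbf{v})^{-1}u_{\mathbf{v}}$. For $\mathbf{v},\mathbf{w}\in Z_t(A)$, $\alpha_t(\mathbf{v},\mathbf{w})=\prod_{1\leq i<j\leq t}\omega_A(w_i,v_j)$. $\mathbb{C}_{\alpha_t}[Z_t(A)]$ is the twisted group algebra with basis $\{b_{\mathbf{v}}\}_{\mathbf{v}\in Z_t(A)}$ and product $b_{\mathbf{v}}b_{\mathbf{w}}=\alpha_t(\mathbf{v},\mathbf{w})b_{\mathbf{v}+\mathbf{w}}$; $\mathrm{Sp}(V_A)$ acts on it by $T\cdot b_{\mathbf{v}}=b_{T\mathbf{v}}$, and the superscript denotes the subalgebra of invariants. *)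

(* Defs.v *)
(* Mathematical Components, with the complex numbers R[i] over R : realType. *)
From HB Require Import structures.
From mathcomp Require Import all_boot all_order all_algebra.
From mathcomp Require Import boolp classical_sets reals.
From mathcomp Require Import complex.

Set Implicit Arguments.
Unset Strict Implicit.
Unset Printing Implicit Defensive.

Import Order.TTheory GRing.Theory Num.Theory.
Local Open Scope ring_scope.

Section Bicharacters.
Variable R : realType.
Local Notation C := R[i].

Definition bicharacter (G : zmodType) (f : G -> G -> C) : Prop :=
  [/\ forall u v, `|f u v| = 1,
      forall u u' v, f (u + u') v = f u v * f u' v &
      forall u v v', f u (v + v') = f u v * f u v'].

Record bichar (G : zmodType) : Type :=
  Bichar { bichar_fun :> G -> G -> C; bicharP : bicharacter bichar_fun }.

Section BicharTheory.
Variables (G : zmodType) (f : bichar G).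

Lemma bichar_neq0 u v : f u v != 0.
Proof. by have [n1 _ _] := bicharP f; rewrite -normr_eq0 n1 oner_eq0. Qed.

Lemma bicharDl u u' v : f (u + u') v = f u v * f u' v.
Proof. by have [] := bicharP f. Qed.

Lemma bicharDr u v v' : f u (v + v') = f u v * f u v'.
Proof. by have [] := bicharP f. Qed.

Lemma bichar0l v : f 0 v = 1.
Proof.
by apply: (mulfI (bichar_neq0 0 v)); rewrite mulr1 -bicharDl addr0.
Qed.

Lemma bichar0r v : f v 0 = 1.
Proof.
by apply: (mulfI (bichar_neq0 v 0)); rewrite mulr1 -bicharDr addr0.
Qed.

End BicharTheory.
End Bicharacters.

(* C_f[G], an element being the function of its coordinates in the basis b_v. *)
Definition twisted_group_algebra (R : realType) (G : finZmodType)
  (f : bichar R G) : Type := {ffun G -> R[i]^o}.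

HB.instance Definition _ R G f :=
  GRing.Lmodule.on (@twisted_group_algebra R G f).

Definition tw_basis (R : realType) (G : finZmodType) (f : bichar R G) (v : G) :
  twisted_group_algebra f := [ffun w => (w == v)%:R].

(* Locked because unification would otherwise keep unfolding the sum. *)
HB.lock Definition tw_mul (R : realType) (G : finZmodType) (f : bichar R G)
    (x y : twisted_group_algebra f) : twisted_group_algebra f :=
  \sum_(v : G) \sum_(w : G) (x v * y w * f v w) *: tw_basis f (v + w).

Section TwistedGroupAlgebra.
Variables (R : realType) (G : finZmodType) (f : bichar R G).
Local Notation C := R[i].
Local Notation CG := (twisted_group_algebra f).

Local Notation tw_basis := (tw_basis f).

Lemma tw_addE (x y : CG) g : (x + y) g = x g + y g.
Proof. exact: ffunE. Qed.

Lemma tw_scaleE (a : C) (x : CG) g : (a *: x) g = a * x g.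
Proof. exact: ffunE. Qed.

Lemma tw_basisE v g : tw_basis v g = (g == v)%:R.
Proof. exact: ffunE. Qed.

Lemma tw_sumE (I : Type) (r : seq I) (P : pred I) (F : I -> CG) g :
  (\sum_(i <- r | P i) F i) g = \sum_(i <- r | P i) F i g.
Proof. exact: sum_ffunE. Qed.

Local Notation tw_mul := (@tw_mul R G f).

Lemma tw_mulE (x y : CG) g :
  tw_mul x y g = \sum_v x v * y (g - v) * f v (g - v).
Proof.
rewrite tw_mul.unlock tw_sumE; apply: eq_bigr => v _; rewrite tw_sumE.
rewrite (bigD1 (g - v)) //= big1 ?addr0 => [|w neq_w].
  by rewrite tw_scaleE tw_basisE [v + _]addrC subrK eqxx mulr1.
rewrite tw_scaleE tw_basisE; case: eqP => [g_vw|_]; last exact: mulr0.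
by case/eqP: neq_w; rewrite g_vw addrC addKr.
Qed.

Lemma tw_mulA : associative tw_mul.
Proof.
move=> x y z; apply/ffunP=> g; rewrite !tw_mulE.
under eq_bigr do rewrite tw_mulE mulr_sumr mulr_suml.
under [RHS]eq_bigr do rewrite tw_mulE !mulr_suml.
rewrite [RHS]exchange_big /=; apply: eq_bigr => v _.
rewrite [RHS](reindex_inj (addrI v)) /=; apply: eq_bigr => w _.
rewrite [v + w]addrC addrK opprD addrA addrAC.
have -> : f v (g - v) = f v w * f v (g - v - w).
  by rewrite -bicharDr [w + _]addrC subrK.
rewrite bicharDl -!mulrA; do 2!congr (_ * _).
by rewrite [RHS]mulrCA; congr (_ * _); rewrite [RHS]mulrCA.
Qed.

Lemma tw_mul1l : left_id (tw_basis 0) tw_mul.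
Proof.
move=> x; apply/ffunP=> g; rewrite tw_mulE (bigD1 0) //= big1 ?addr0 => [|v v0].
  by rewrite tw_basisE eqxx subr0 bichar0l mulr1 mul1r.
by rewrite tw_basisE (negPf v0) !mul0r.
Qed.

Lemma tw_mul1r : right_id (tw_basis 0) tw_mul.
Proof.
move=> x; apply/ffunP=> g; rewrite tw_mulE (bigD1 g) //= big1 ?addr0 => [|v vg].
  by rewrite tw_basisE subrr eqxx bichar0r !mulr1.
by rewrite tw_basisE subr_eq0 eq_sym (negPf vg) mulr0 mul0r.
Qed.

Lemma tw_mulDl : left_distributive tw_mul +%R.
Proof.
move=> x y z; apply/ffunP=> g; rewrite [RHS](tw_addE (tw_mul _ _)) !tw_mulE -big_split.
by apply: eq_bigr => v _; rewrite tw_addE !mulrDl.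
Qed.

Lemma tw_mulDr : right_distributive tw_mul +%R.
Proof.
move=> x y z; apply/ffunP=> g; rewrite [RHS](tw_addE (tw_mul _ _)) !tw_mulE -big_split.
by apply: eq_bigr => v _; rewrite tw_addE mulrDr mulrDl.
Qed.

Lemma tw_basis0_neq0 : tw_basis 0 != 0.
Proof.
by apply/eqP=> /ffunP/(_ 0)/eqP; rewrite !ffunE eqxx oner_eq0.
Qed.

HB.instance Definition _ := GRing.Zmodule_isNzRing.Build CG
  tw_mulA tw_mul1l tw_mul1r tw_mulDl tw_mulDr tw_basis0_neq0.

Lemma tw_scalerAl (a : C) (x y : CG) : a *: (x * y) = (a *: x) * y.
Proof.
apply/ffunP=> g; rewrite tw_scaleE [RHS]tw_mulE [(x * y) g]tw_mulE mulr_sumr.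
by apply: eq_bigr => v _; rewrite tw_scaleE !mulrA.
Qed.

HB.instance Definition _ := GRing.Lmodule_isLalgebra.Build C CG tw_scalerAl.

Lemma tw_scalerAr (a : C) (x y : CG) : a *: (x * y) = x * (a *: y).
Proof.
apply/ffunP=> g; rewrite tw_scaleE [RHS]tw_mulE [(x * y) g]tw_mulE mulr_sumr.
by apply: eq_bigr => v _; rewrite tw_scaleE mulrA [x v * (a * _)]mulrCA -!mulrA.
Qed.

HB.instance Definition _ := GRing.Lalgebra_isAlgebra.Build C CG tw_scalerAr.

Lemma tw_basisM (v w : G) :
  tw_basis v * tw_basis w = f v w *: tw_basis (v + w).
Proof.
apply/ffunP=> g; rewrite [LHS]tw_mulE tw_scaleE (bigD1 v) //= big1 => [|u uv].
  rewrite !tw_basisE eqxx mul1r addr0 subr_eq [w + v]addrC.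
  by case: eqP => [->|_]; rewrite ?mul0r ?mulr0 // [v + w]addrC addrK mulrC.
by rewrite tw_basisE (negPf uv) !mul0r.
Qed.

Lemma tw_scaleMM (a b : C) (x y : CG) : (a *: x) * (b *: y) = (a * b) *: (x * y).
Proof. by rewrite -scalerAl -scalerAr scalerA. Qed.

Lemma tw_basis_sum (x : CG) : x = \sum_v x v *: tw_basis v.
Proof.
apply/ffunP=> g; rewrite tw_sumE (bigD1 g) //= big1 ?addr0 => [|v vg].
  by rewrite tw_scaleE tw_basisE eqxx mulr1.
by rewrite tw_scaleE tw_basisE eq_sym (negPf vg) mulr0.
Qed.

End TwistedGroupAlgebra.

Section Dual.
Variables (R : realType) (A : finZmodType).
Local Notation C := R[i].

Definition is_character (chi : {ffun A -> C}) : bool :=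
  [forall a, `|chi a| == 1] &&
  [forall a, forall b, chi (a + b) == chi a * chi b].

(* Hom(A, U(1)); below, its group law is the pointwise product, written
   additively. *)
Record dual : Type :=
  Dual { dual_val :> {ffun A -> C}; _ : is_character dual_val }.

HB.instance Definition _ := [isSub for dual_val].
HB.instance Definition _ := [Choice of dual by <:].

Implicit Types chi psi : dual.

Lemma dual_norm chi a : `|chi a| = 1.
Proof. by case: chi => chi /= /andP[/forallP/(_ a)/eqP]. Qed.

Lemma dualD chi a b : chi (a + b) = chi a * chi b.
Proof.
by case: chi => chi /= /andP[_ /forallP/(_ a)/forallP/(_ b)/eqP].
Qed.

Lemma dual_neq0 chi a : chi a != 0.
Proof. by rewrite -normr_eq0 dual_norm oner_eq0. Qed.

Lemma dual0 chi : chi 0 = 1.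
Proof. by apply: (mulfI (dual_neq0 chi 0)); rewrite mulr1 -dualD addr0. Qed.

Fact dual_zero_subproof : is_character [ffun=> 1].
Proof.
apply/andP; split; apply/forallP=> a; first by rewrite ffunE normr1.
by apply/forallP=> b; rewrite !ffunE mulr1.
Qed.
Definition dual_zero := Dual dual_zero_subproof.

Fact dual_opp_subproof chi : is_character [ffun a => (chi a)^-1].
Proof.
apply/andP; split; apply/forallP=> a.
  by rewrite ffunE normfV dual_norm invr1.
by apply/forallP=> b; rewrite !ffunE dualD invfM.
Qed.
Definition dual_opp chi := Dual (dual_opp_subproof chi).

Fact dual_add_subproof chi psi : is_character [ffun a => chi a * psi a].
Proof.
apply/andP; split; apply/forallP=> a.
  by rewrite ffunE normrM !dual_norm mulr1.
by apply/forallP=> b; rewrite !ffunE !dualD mulrACA.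
Qed.
Definition dual_add chi psi := Dual (dual_add_subproof chi psi).

Fact dual_addA : associative dual_add.
Proof. by move=> ? ? ?; apply/val_inj/ffunP=> a; rewrite !ffunE mulrA. Qed.
Fact dual_addC : commutative dual_add.
Proof. by move=> ? ?; apply/val_inj/ffunP=> a; rewrite !ffunE mulrC. Qed.
Fact dual_add0 : left_id dual_zero dual_add.
Proof. by move=> ?; apply/val_inj/ffunP=> a; rewrite !ffunE mul1r. Qed.
Fact dual_addN : left_inverse dual_zero dual_opp dual_add.
Proof.
by move=> chi; apply/val_inj/ffunP=> a; rewrite !ffunE mulVf ?dual_neq0.
Qed.

HB.instance Definition _ :=
  GRing.isZmodule.Build dual dual_addA dual_addC dual_add0 dual_addN.

(* Characters take values in the #|A|-th roots of unity, hence are finitely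
   many. *)
Lemma dual_expr chi a : chi a ^+ #|A| = 1.
Proof.
have prod_neq0 : \prod_b chi b != 0.
  by apply/prodf_neq0 => b _; apply: dual_neq0.
apply: (mulIf prod_neq0); rewrite mul1r [RHS](reindex_inj (addrI a)) /=.
under [RHS]eq_bigr do rewrite dualD.
by rewrite big_split prodr_const.
Qed.

Let unity_roots : seq C :=
  sval (closed_field_poly_normal ('X^#|A| - 1 : {poly C})).

Let mem_unity_roots chi a : chi a \in unity_roots.
Proof.
rewrite /unity_roots; case: closed_field_poly_normal => rs /= def_p.
have A_gt0 : (0 < #|A|)%N by apply/card_gt0P; exists 0.
have lead1 : lead_coef ('X^#|A| - 1 : {poly C}) = 1.
  by rewrite -[1]/(1%:P) lead_coefXnsubC.
rewrite -root_prod_XsubC -[X in root X _]scale1r -lead1 -def_p.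
by rewrite rootE !hornerE dual_expr subrr.
Qed.

Let dual_code chi : {ffun A -> 'I_(size unity_roots).+1} :=
  [ffun a => inord (index (chi a) unity_roots)].

Let dual_decode (c : {ffun A -> 'I_(size unity_roots).+1}) : option dual :=
  insub [ffun a => unity_roots`_(c a)].

Let dual_codeK : pcancel dual_code dual_decode.
Proof.
move=> chi; rewrite /dual_decode.
suff -> : [ffun a => unity_roots`_(dual_code chi a)] = val chi by rewrite valK.
apply/ffunP=> a; rewrite !ffunE inordK ?nth_index ?mem_unity_roots //.
by rewrite ltnS index_size.
Qed.

HB.instance Definition _ : isCountable dual := PCanIsCountable dual_codeK.
HB.instance Definition _ : isFinite dual := PCanIsFinite dual_codeK.

End Dual.

Section PhaseSpace.
Variables (R : realType) (A : finZmodType).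
Local Notation C := R[i].

Definition phase_space : Type := (A * dual R A)%type.
HB.instance Definition _ := Finite.on phase_space.
HB.instance Definition _ := GRing.Zmodule.on phase_space.
Local Notation V := phase_space.

Definition beta (u v : V) : C := u.2 v.1.

Definition omega (u v : V) : C := beta u v * (beta v u)^-1.

Definition symplectic (T : {additive V -> V}) : Prop :=
  bijective T /\ forall u v, omega (T u) (T v) = omega u v.

Lemma beta_bichar : bicharacter beta.
Proof.
split=> *; first exact: dual_norm; last exact: dualD.
by rewrite /beta /= ffunE.
Qed.

Lemma omega_bichar : bicharacter omega.
Proof.
have [n1 Dl Dr] := beta_bichar; rewrite /omega; split=> *.
- by rewrite normrM normfV !n1 invr1 mulr1.
- by rewrite Dl Dr invfM mulrACA.
- by rewrite Dl Dr invfM mulrACA.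
Qed.

End PhaseSpace.

(* Operators on C[T], for T a finite set, are the matrices in the basis |b>,
   b : T, whose elements are numbered by enum_rank; they act on column vectors.
   In particular H = C[A], and its t-th tensor power is C[A^t] with basis
   |b_1> (x) ... (x) |b_t>. *)
Notation operator R T := 'M[R[i]]_#|{: T}|.

Section Clifford.
Variables (R : realType) (A : finZmodType) (t : nat).
Local Notation C := R[i].
Local Notation V := (phase_space R A).

Definition weyl (v : V) : operator R A :=
  \matrix_(i, j) (if enum_val i == v.1 + enum_val j
                  then v.2 (enum_val j) else 0).

Local Open Scope classical_set_scope.

Definition U1 : set C := [set z | `|z| = 1].

Definition heisenberg_group : set (operator R A) :=
  [set M | exists z v, U1 z /\ M = z *: weyl v].

Definition heisenberg_normalizer : set (operator R A) :=
  [set U | U \is unitarymx /\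
     [set U *m M *m invmx U | M in heisenberg_group] = heisenberg_group].

(* The quotient by the scalars U(1): an element is the set of its unitary
   representatives. *)
Definition clifford_group : set (set (operator R A)) :=
  [set [set z *: U | z in U1] | U in heisenberg_normalizer].

Local Close Scope classical_set_scope.

Definition tensor_op (M : 'I_t -> operator R A) :
    operator R {ffun 'I_t -> A} :=
  \matrix_(i, j)
    let a : {ffun 'I_t -> A} := enum_val i in
    let b : {ffun 'I_t -> A} := enum_val j in
    \prod_(k < t) M k (enum_rank (a k)) (enum_rank (b k)).

Definition commutant_pred : {pred operator R {ffun 'I_t -> A}} :=
  fun X => `[< forall g, clifford_group g -> forall U, g U ->
    X *m tensor_op (fun=> U) = tensor_op (fun=> U) *m X >].

Fact commutant_subring_closed : subring_closed commutant_pred.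
Proof.
split=> [|X Y /asboolP cX /asboolP cY|X Y /asboolP cX /asboolP cY];
  apply/asboolP=> g Cg U gU.
- by rewrite mul1mx mulmx1.
- by rewrite mulmxBl mulmxBr (cX g) // (cY g).
- by rewrite -mulmxA (cY g) // mulmxA (cX g) // -mulmxA.
Qed.

Fact commutant_scale_closed : GRing.scaler_closed commutant_pred.
Proof.
move=> a X /asboolP cX; apply/asboolP=> g Cg U gU.
by rewrite -scalemxAl -scalemxAr (cX g).
Qed.

HB.instance Definition _ :=
  GRing.isSubringClosed.Build _ commutant_pred commutant_subring_closed.
HB.instance Definition _ :=
  GRing.isScaleClosed.Build C _ commutant_pred commutant_scale_closed.

Record commutant : Type := Commutant
  { commutant_val :> operator R {ffun 'I_t -> A};
    _ : commutant_val \in commutant_pred }.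

HB.instance Definition _ := [isSub for commutant_val].
HB.instance Definition _ := [Choice of commutant by <:].
HB.instance Definition _ := [SubChoice_isSubZmodule of commutant by <:].
HB.instance Definition _ := [SubZmodule_isSubLmodule of commutant by <:].
HB.instance Definition _ :=
  GRing.SubZmodule_isSubPzRing.Build _ _ commutant (subringClosedP _).

Fact commutant_oner_neq0 : (1 : commutant) != 0.
Proof.
apply/eqP=> /(congr1 val)/matrixP /= e10.
pose i := enum_rank [ffun=> 0 : A] : 'I_#|{: {ffun 'I_t -> A}}|.
by have /eqP := e10 i i; rewrite !mxE eqxx oner_eq0.
Qed.

HB.instance Definition _ :=
  GRing.PzSemiRing_isNonZero.Build commutant commutant_oner_neq0.

Fact commutant_scalerAl (a : C) (x y : commutant) : a *: (x * y) = a *: x * y.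
Proof. by apply: val_inj; apply: scalemxAl. Qed.

HB.instance Definition _ :=
  GRing.Lmodule_isLalgebra.Build C commutant commutant_scalerAl.

Fact commutant_scalerAr (a : C) (x y : commutant) : a *: (x * y) = x * (a *: y).
Proof. by apply: val_inj; apply: scalemxAr. Qed.

HB.instance Definition _ :=
  GRing.Lalgebra_isAlgebra.Build C commutant commutant_scalerAr.

End Clifford.

Section Tuples.
Variables (R : realType) (A : finZmodType) (t : nat).
Local Notation C := R[i].
Local Notation V := (phase_space R A).

Definition zero_sum : {pred {ffun 'I_t -> V}} := fun v => \sum_i v i == 0.

Fact zero_sum_closed : zmod_closed zero_sum.
Proof.
split=> [|u v /eqP u0 /eqP v0]; rewrite unfold_in.
  by rewrite big1 // => i _; rewrite ffunE.
under eq_bigr do rewrite !ffunE.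
by rewrite sumrB u0 v0 subrr.
Qed.

HB.instance Definition _ :=
  GRing.isZmodClosed.Build _ zero_sum zero_sum_closed.

Record zero_tuple : Type :=
  ZeroTuple { tuple_of_zero :> {ffun 'I_t -> V}; _ : tuple_of_zero \in zero_sum }.

HB.instance Definition _ := [isSub for tuple_of_zero].
HB.instance Definition _ := [Finite of zero_tuple by <:].
HB.instance Definition _ := [SubChoice_isSubZmodule of zero_tuple by <:].

Implicit Types v w : zero_tuple.

Fact sp_act_subproof (T : {additive V -> V}) v :
  [ffun i => T (v i)] \in zero_sum.
Proof.
have /eqP v0 := valP v; rewrite unfold_in.
by under eq_bigr do rewrite ffunE; rewrite -raddf_sum v0 raddf0.
Qed.
Definition sp_act (T : {additive V -> V}) v : zero_tuple :=
  ZeroTuple (sp_act_subproof T v).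

Definition kappa v : C :=
  \prod_(i < t) \prod_(j < t | (i < j)%N) beta (v i) (v j).

Definition weyl_tuple v : operator R {ffun 'I_t -> A} :=
  tensor_op (fun i => weyl (v i)).

Definition weyl_tilde v : operator R {ffun 'I_t -> A} :=
  (kappa v)^-1 *: weyl_tuple v.

Definition alpha v w : C :=
  \prod_(i < t) \prod_(j < t | (i < j)%N) omega (w i) (v j).

Lemma alpha_bicharacter : bicharacter alpha.
Proof.
have [n1 Dl Dr] := omega_bichar R A.
split=> [u v|u u' v|u v v']; rewrite /alpha.
- by rewrite normr_prod big1 // => i _; rewrite normr_prod big1.
- rewrite -big_split; apply: eq_bigr => i _ /=; rewrite -big_split.
  by apply: eq_bigr => j _; rewrite ffunE Dr.
- rewrite -big_split; apply: eq_bigr => i _ /=; rewrite -big_split.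
  by apply: eq_bigr => j _; rewrite ffunE Dl.
Qed.

Definition alpha_bichar : bichar R zero_tuple := Bichar alpha_bicharacter.

Lemma alpha_invariant (T : {additive V -> V}) v w :
  symplectic T -> alpha (sp_act T v) (sp_act T w) = alpha v w.
Proof.
case=> _ T_omega; apply: eq_bigr => i _; apply: eq_bigr => j _.
by rewrite !ffunE T_omega.
Qed.

Local Notation tw := (twisted_group_algebra alpha_bichar).

Definition sp_act_alg (T : {additive V -> V}) (x : tw) : tw :=
  \sum_v x v *: tw_basis alpha_bichar (sp_act T v).

Definition invariant_pred : {pred tw} :=
  fun x => `[< forall T, symplectic T -> sp_act_alg T x = x >].

Lemma sp_act_alg_linear T : linear (sp_act_alg T).
Proof.
move=> a x y; rewrite /sp_act_alg scaler_sumr -big_split.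
by apply: eq_bigr => v _; rewrite tw_addE tw_scaleE scalerDl scalerA.
Qed.

HB.instance Definition _ T :=
  GRing.isLinear.Build C tw tw *:%R (sp_act_alg T) (@sp_act_alg_linear T).

Lemma sp_act_alg_basis T v :
  sp_act_alg T (tw_basis alpha_bichar v) = tw_basis alpha_bichar (sp_act T v).
Proof.
rewrite /sp_act_alg (bigD1 v) //= big1 ?addr0 => [|w wv].
  by rewrite tw_basisE eqxx scale1r.
by rewrite tw_basisE (negPf wv) scale0r.
Qed.

Lemma sp_actD T v w : sp_act T (v + w) = sp_act T v + sp_act T w.
Proof. by apply/val_inj/ffunP=> i; rewrite !ffunE raddfD. Qed.

Lemma sp_act_algM T (x y : tw) : symplectic T ->
  sp_act_alg T (x * y) = sp_act_alg T x * sp_act_alg T y.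
Proof.
move=> spT; rewrite [x]tw_basis_sum [y]tw_basis_sum.
rewrite mulr_suml !linear_sum mulr_suml; apply: eq_bigr => v _ /=.
rewrite !mulr_sumr linear_sum; apply: eq_bigr => w _ /=.
have actZ a z : sp_act_alg T (a *: z) = a *: sp_act_alg T z by rewrite linearZ.
rewrite tw_scaleMM tw_basisM scalerA (actZ (x v * y w * _)) (actZ (x v)).
rewrite (actZ (y w)) !sp_act_alg_basis tw_scaleMM sp_actD.
by rewrite [in RHS]tw_basisM scalerA /= alpha_invariant.
Qed.

Fact invariant_subalg_closed : GRing.subalg_closed invariant_pred.
Proof.
split=> [|a x y /asboolP ix /asboolP iy|x y /asboolP ix /asboolP iy];
  apply/asboolP=> T spT.
- rewrite [1]/(tw_basis alpha_bichar 0) sp_act_alg_basis; congr tw_basis.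
  by apply/val_inj/ffunP=> i; rewrite !ffunE raddf0.
- by rewrite linearP /= ix // iy.
- by rewrite sp_act_algM // ix // iy.
Qed.

HB.instance Definition _ := GRing.isSubalgClosed.Build C tw invariant_pred
  invariant_subalg_closed.

Record invariants : Type := Invariants
  { invariants_val :> tw; _ : invariants_val \in invariant_pred }.

HB.instance Definition _ := [isSub for invariants_val].
HB.instance Definition _ := [Choice of invariants by <:].
HB.instance Definition _ := [SubChoice_isSubAlgebra of invariants by <:].

End Tuples.

Definition algebra_isomorphic (K : fieldType) (D E : algType K) : Prop :=
  exists f : {lrmorphism D -> E}, bijective f.

(* Main.v *)
From HB Require Import structures.
Require Import Defs.
From mathcomp Require Import all_boot all_order all_algebra reals complex.
From mathcomp Require Import boolp classical_sets ring.
Import Order.TTheory GRing.Theory Num.Theory.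
Set Implicit Arguments.
Unset Strict Implicit.
Local Open Scope ring_scope.
Local Open Scope sesquilinear_scope.

(** Weyl operators on C[A] compose by u_v u_w = beta(v, w) u_(v+w). For tuples
    the scalars prod_i beta(v_i, w_i) and the off-diagonal ones coming from
    kappa(v + w) combine, and since the w_j sum to zero the product of
    beta(v_i, w_j) over all (i, j) is 1: what is left is alpha(v, w)
    ([weyl_tildeM]).  So b_v |-> u~_v extends to an algebra morphism [realize]
    from the twisted group algebra to operators, and the isomorphism is its
    restriction to the invariants.

    - [realize] is injective because a trace isolates each coefficient
      ([realize_inj]).
    - Every element of the commutant is in its image ([commutant_realize]).
      Tensor products of Weyl operators span all operators; averaging over
      conjugation by the u_w^(x)t, which are Clifford, fixes the commutant,
      and kills the tuples of nonzero sum because omega is nondegenerate.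
    - If U u_v U^-1 = l(v) u_(Tv), then U^(x)t conjugates u~_v to u~_(Tv)
      exactly ([tensor_weyl_tilde]): l is a quadratic function whose polar
      form is beta(T., T.) / beta, so on a zero-sum tuple prod_i l(v_i) equals
      kappa(v) / kappa(Tv).  Hence commuting with the Clifford group amounts to
      invariance under those T which come from Clifford elements.
    - These T are exactly the symplectic ones. That they are symplectic follows
      by comparing scalars in products. Conversely, given T, the operators
      u_(T(0, chi)) commute and have a common unit eigenvector psi, and the
      vectors u_(T(a, 0)) psi, after a change of phases, form an orthonormal
      basis whose transition matrix implements T ([symplectic_lift]).  The
      phases must trivialize the cocycle beta(T(a, 0), T(b, 0)), which is what
      the eigenvalues of the commuting operators u_(T(a, 0)) on a common
      eigenvector do.

    Nondegeneracy of omega and the spanning property both rest on the fact that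
    characters separate the points of A ([dual_separates]), proved by
    diagonalizing all translations of C[A] at once. *)

(* The matrix entry <a| M |b>. *)
Local Notation ent M a b := (M (enum_rank a) (enum_rank b)).

(** * Matrices indexed by a finite type *)

Section Operators.
Variables (R : realType) (T : finType).
Local Notation C := R[i].
Implicit Types M N : operator R T.

Lemma operator_ext M N : (forall a b, ent M a b = ent N a b) -> M = N.
Proof.
move=> eqMN; apply/matrixP=> i j.
by rewrite -(enum_valK i) -(enum_valK j) eqMN.
Qed.

Lemma sum_enum_rank (F : 'I_#|T| -> C) : \sum_i F i = \sum_a F (enum_rank a).
Proof.
by rewrite (reindex (@enum_rank T)) //; apply/onW_bij/enum_rank_bij.
Qed.

Lemma ent_mul M N a b : ent (M *m N) a b = \sum_c ent M a c * ent N c b.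
Proof. by rewrite mxE sum_enum_rank. Qed.

Lemma ent_one a b : ent (1%:M : operator R T) a b = (a == b)%:R.
Proof. by rewrite mxE (inj_eq enum_rank_inj). Qed.

End Operators.

(** * Weyl operators *)

Section Weyl.
Variables (R : realType) (A : finZmodType).
Local Notation C := R[i].
Local Notation V := (phase_space R A).
Local Notation weyl := (@weyl R A).
Implicit Types v w : V.

Definition beta_form : bichar R V := Bichar (beta_bichar R A).
Definition omega_form : bichar R V := Bichar (omega_bichar R A).

Lemma beta_neq0 (x y : V) : beta x y != 0.
Proof. exact: bichar_neq0 beta_form x y. Qed.

Lemma betaDl (x y z : V) : beta (x + y) z = beta x z * beta y z.
Proof. exact: bicharDl beta_form x y z. Qed.

Lemma betaDr (x y z : V) : beta x (y + z) = beta x y * beta x z.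
Proof. exact: bicharDr beta_form x y z. Qed.

Lemma beta0r (x : V) : beta x 0 = 1.
Proof. exact: bichar0r beta_form x. Qed.

Lemma omegaDl (x y z : V) : omega (x + y) z = omega x z * omega y z.
Proof. exact: bicharDl omega_form x y z. Qed.

Lemma omegaDr (x y z : V) : omega x (y + z) = omega x y * omega x z.
Proof. exact: bicharDr omega_form x y z. Qed.

Lemma omega0r (x : V) : omega x 0 = 1.
Proof. exact: bichar0r omega_form x. Qed.

Lemma omega_swap v w : beta v w = omega v w * beta w v.
Proof. by rewrite mulfVK // beta_neq0. Qed.

Lemma dual_nontrivial (chi : dual R A) : chi != 0 -> exists a, chi a != 1.
Proof.
move=> chi0; apply/existsP; apply: contraNT chi0 => /existsPn chi1.
apply/eqP/val_inj/ffunP=> a; rewrite ffunE; apply/eqP.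
by have := chi1 a; rewrite negbK.
Qed.

Lemma ent_weyl v a b :
  ent (weyl v) a b = if a == v.1 + b then v.2 b else 0.
Proof. by rewrite mxE !enum_rankK. Qed.

Lemma weylM v w : weyl v *m weyl w = beta v w *: weyl (v + w).
Proof.
apply: operator_ext => a b; rewrite ent_mul (bigD1 (w.1 + b)) //= big1.
  rewrite addr0 !mxE !enum_rankK /= eqxx addrA.
  case: eqP => _; rewrite ?mulr0 ?mul0r //.
  by rewrite dualD ffunE -!mulrA; congr (_ * _).
by move=> c; rewrite [ent _ c b]ent_weyl => /negPf ->; rewrite mulr0.
Qed.

Lemma weyl0 : weyl 0 = 1%:M.
Proof.
apply: operator_ext => a b; rewrite ent_weyl ent_one /= add0r ffunE.
by case: eqP.
Qed.

Lemma weyl_commute v w : weyl v *m weyl w = omega v w *: (weyl w *m weyl v).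
Proof. by rewrite !weylM [w + v]addrC scalerA -omega_swap. Qed.

Lemma weyl_unitary v : weyl v \is unitarymx.
Proof.
apply/unitarymxP/operator_ext => a b; rewrite ent_mul ent_one.
rewrite (bigD1 (a - v.1)) //= big1 ?addr0 => [|c].
  rewrite !mxE !enum_rankK addrC subrK eqxx.
  rewrite [b == a]eq_sym; case: eqP => _; last by rewrite conjC0 mulr0.
  by rewrite -normCK dual_norm expr1n.
rewrite [ent (weyl v) a c]ent_weyl eq_sym subr_eq [c + _]addrC => /negPf ->.
by rewrite mul0r.
Qed.

Lemma weyl_unit v : weyl v \in unitmx.
Proof. exact/unitarymx_unit/weyl_unitary. Qed.

Lemma cardA_neq0 : #|A|%:R != 0 :> C.
Proof. by rewrite pnatr_eq0 -lt0n; apply/card_gt0P; exists 0. Qed.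

(** Translating the variable of summation by y multiplies the sum by h y. *)
Lemma sum_hom_eq0 (G : finZmodType) (h : G -> C) :
  (forall x y, h (x + y) = h x * h y) -> (exists x, h x != 1) ->
  \sum_x h x = 0.
Proof.
move=> hD [y hy]; apply/eqP.
have : (h y - 1) * (\sum_x h x) == 0.
  rewrite mulrBl mul1r mulr_sumr subr_eq0; apply/eqP.
  by rewrite [RHS](reindex_inj (addrI y)) /=; apply: eq_bigr => x _; rewrite hD.
by rewrite mulf_eq0 subr_eq0 (negPf hy).
Qed.

Lemma weyl_trace v : \tr (weyl v) = if v == 0 then #|A|%:R else 0.
Proof.
rewrite /mxtrace sum_enum_rank.
under eq_bigr do rewrite ent_weyl -[X in X == _]add0r (inj_eq (addIr _)).
case: v => a chi; rewrite -pair_eqE /= [0 == a]eq_sym.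
case: (a =P 0) => _ /=; last by rewrite sumr_const mul0rn.
case: eqP => [->|/eqP chi0].
  by under eq_bigr do rewrite ffunE; rewrite sumr_const.
by apply: sum_hom_eq0; [exact: dualD | exact: dual_nontrivial].
Qed.

Lemma weyl_neq0 v : weyl v != 0.
Proof.
have rank_v := mxrank_unitary (weyl_unitary v).
apply: contraTneq isT => v0; move: rank_v; rewrite v0 mxrank0 => A0.
by have := cardA_neq0; rewrite -A0 eqxx.
Qed.

(** Weyl operators with different labels are not even proportional: the traces
    of their products with u_(-w) tell them apart. *)
Lemma weyl_proportional (c : C) v w : weyl v = c *: weyl w -> v = w.
Proof.
move=> vw; have c0 : c != 0.
  by apply: contra_neq (weyl_neq0 v) => c0; rewrite vw c0 scale0r.
have := congr1 (fun M => \tr (M *m weyl (- w))) vw.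
rewrite -scalemxAl !weylM subrr !mxtraceZ !weyl_trace eqxx subr_eq0.
case: eqP => // _; rewrite mulr0 => /esym/eqP.
by rewrite !mulf_eq0 (negPf c0) (negPf (beta_neq0 _ _)) (negPf cardA_neq0).
Qed.

End Weyl.

(** * Unitary matrices and their eigenvectors *)

Section Unitary.
Variables (C : numClosedFieldType) (n : nat).

Lemma unitary_mulVmx (W : 'M[C]_n) : W \is unitarymx -> W^t* *m W = 1%:M.
Proof. by move/unitarymxP/mulmx1C. Qed.

Lemma unitary_normal (W : 'M[C]_n) : W \is unitarymx -> W \is normalmx.
Proof.
by move=> uW; apply/normalmxP; rewrite (elimT unitarymxP uW) unitary_mulVmx.
Qed.

Lemma commuting_unitary_diag (I : finType) (F : I -> 'M[C]_n) :
  (forall i, F i \is unitarymx) -> (forall i j, comm_mx (F i) (F j)) ->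
  exists2 P, P \in unitmx &
    exists d : I -> 'rV_n, forall i, F i *m P = P *m diag_mx (d i).
Proof.
move=> uF cF.
have diagF i : diagonalizable (F i).
  have /orthomx_spectralP defF := unitary_normal (uF i).
  exists (spectralmx (F i)); first exact: spectral_unit.
  apply/(diagonalizable_forPex (P := spectralmx (F i))).
  exists (spectral_diag (F i)); apply/simmxP; first exact: spectral_unit.
  by rewrite [X in _ *m X = _]defF !mulmxA mulmxV ?spectral_unit // mul1mx.
have [|P Pu /allP/= PF] := (codiagonalizableP [seq F i | i <- enum I]).1.
  split=> [_ _ /mapP[i _ ->] /mapP[j _ ->]|_ /mapP[i _ ->]] //; exact: cF.
exists (invmx P); first by rewrite unitmx_inv.
suff /choice[d dP] i : exists d : 'rV_n, F i *m invmx P = invmx P *m diag_mx d.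
  by exists d.
have /PF/diagonalizable_forPex[d /(simmxP Pu) dP] :
  F i \in [seq F i | i <- enum I] by rewrite map_f ?mem_enum.
exists d; apply: (canRL (mulKmx Pu)).
by rewrite mulmxA dP mulmxK.
Qed.

Lemma unit_col_neq0 (P : 'M[C]_n) k : P \in unitmx -> col k P != 0.
Proof.
move=> Pu; apply: contraTneq isT => /(congr1 (mulmx (invmx P))).
rewrite colE mulKmx // mulmx0 => /colP/(_ k)/eqP.
by rewrite !mxE eqxx oner_eq0.
Qed.

Lemma diag_col_eigen (M P : 'M[C]_n) (d : 'rV_n) k :
  M *m P = P *m diag_mx d -> M *m col k P = d 0 k *: col k P.
Proof.
move=> MP; rewrite !colE mulmxA MP -mulmxA scalemxAr; congr (_ *m _).
apply/colP=> j; rewrite mul_diag_mx !mxE eqxx andbT.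
by case: eqP => [->|_]; rewrite ?mulr0.
Qed.

Definition cdot (x y : 'cV[C]_n) : C := (x^t* *m y) 0 0.

Lemma cdot_gt0 x : x != 0 -> 0 < cdot x x.
Proof.
move=> x0; have -> : cdot x x = dotmx (x^t*) (x^t*) by rewrite dotmxE trmxCK.
apply: dotmx_is_dotmx; apply: contra_neq x0 => x0.
by rewrite -[x]trmxCK x0 trmx0 map_mx0.
Qed.

Lemma cdotZ (a b : C) x y : cdot (a *: x) (b *: y) = a^* * b * cdot x y.
Proof.
rewrite /cdot !mxE mulr_sumr; apply: eq_bigr => k _.
by rewrite !mxE rmorphM mulrACA.
Qed.

Lemma cdot_unitary (W : 'M[C]_n) x y :
  W \is unitarymx -> cdot (W *m x) (W *m y) = cdot x y.
Proof.
move=> uW; rewrite /cdot trmx_mul map_mxM -mulmxA [_ *m (W *m y)]mulmxA.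
by rewrite unitary_mulVmx // mul1mx.
Qed.

Lemma unitary_eigenvalue_norm (W : 'M[C]_n) (x : 'cV_n) (mu : C) :
  W \is unitarymx -> x != 0 -> W *m x = mu *: x -> `|mu| = 1.
Proof.
move=> uW x0 Wx; have xx0 : cdot x x != 0 by rewrite gt_eqF ?cdot_gt0.
apply/eqP; rewrite -sqrp_eq1 ?normr_ge0 // normCKC; apply/eqP/(mulIf xx0).
by rewrite mul1r -cdotZ -Wx cdot_unitary.
Qed.

Lemma unitary_scale_norm (W : 'M[C]_n) (z : C) : (0 < n)%N ->
  W \is unitarymx -> z *: W \is unitarymx -> `|z| = 1.
Proof.
move=> n0 uW uzW; pose x : 'cV[C]_n := const_mx 1.
have x0 : x != 0.
  by apply/eqP=> /colP/(_ (Ordinal n0)); rewrite !mxE => /eqP; rewrite oner_eq0.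
(* z is an eigenvalue of the unitary matrix z *: W *m W^t*. *)
apply: (@unitary_eigenvalue_norm (z *: W *m W^t*) x) => //.
  by rewrite mul_unitarymx // trmxC_unitary.
by rewrite -!scalemxAl (elimT unitarymxP uW) mul1mx.
Qed.

End Unitary.

(** * Separation of points by characters *)

Section Separation.
Variables (R : realType) (A : finZmodType).
Local Notation C := R[i].
Local Notation V := (phase_space R A).
Local Notation weyl := (@weyl R A).

(** The translations of C[A] are commuting unitaries, hence all diagonal in a
    suitable basis, where each diagonal entry is a character. If all of these
    were 1 at a, the translation by a would be the identity. *)
Lemma dual_separates (a : A) : a != 0 -> exists chi : dual R A, chi a != 1.
Proof.
move=> a0.
pose S b : operator R A := weyl (b, 0).
have SM b c : S b *m S c = S (b + c).
  by rewrite weylM [beta _ _]ffunE scale1r; congr (weyl (_, _)); apply: addr0.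
have [||P Pu [d dP]] := @commuting_unitary_diag R[i] #|A| A S.
- by move=> b; apply: weyl_unitary.
- by move=> b c; rewrite /comm_mx !SM addrC.
have dM b c k : d (b + c) 0 k = d b 0 k * d c 0 k.
  have : diag_mx (d (b + c)) = diag_mx (d b) *m diag_mx (d c).
    apply: (can_inj (mulKmx Pu)); rewrite mulmxA -!dP -mulmxA -dP mulmxA.
    by rewrite SM.
  by rewrite mulmx_diag => /matrixP/(_ k k); rewrite !mxE eqxx.
have d1 b k : `|d b 0 k| = 1.
  apply: unitary_eigenvalue_norm (weyl_unitary _) (unit_col_neq0 k Pu) _.
  exact: diag_col_eigen (dP b).
have [/existsP[k dk]|/existsPn d_a] := boolP [exists k, d a 0 k != 1].
  have chiP : @is_character R A [ffun b => d b 0 k].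
    apply/andP; split; apply/forallP=> b; first by rewrite ffunE d1.
    by apply/forallP=> c; rewrite !ffunE dM.
  by exists (Dual chiP); rewrite /= ffunE.
have: S a = 1%:M.
  apply: (can_inj (mulmxK Pu)); rewrite mul1mx dP -[RHS]mulmx1; congr (_ *m _).
  apply/matrixP=> i k; rewrite !mxE; have := d_a k; rewrite negbK => /eqP dk.
  by case: (i =P k) => // ->; rewrite dk.
rewrite -weyl0 -[weyl 0]scale1r => /weyl_proportional[a_eq0].
by rewrite a_eq0 eqxx in a0.
Qed.

Lemma omega_nondegenerate (s : V) : s != 0 -> exists w, omega w s != 1.
Proof.
case: s => a chi s0; have [a0|a0] := eqVneq a 0; last first.
  have [psi psi_a] := dual_separates a0; exists (0, psi).
  by rewrite /omega /beta /= dual0 invr1 mulr1.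
have [|b chi_b] := @dual_nontrivial R A chi.
  by apply: contraNneq s0 => chi0; rewrite a0 chi0.
by exists (b, 0); rewrite /omega /beta /= ffunE mul1r invr_eq1.
Qed.

(** Fourier inversion along each diagonal {(x + b, b) | b in A} of M. *)
Lemma weyl_span (M : operator R A) :
  exists c : V -> C, M = \sum_v c v *: weyl v.
Proof.
have card0 : #|{: dual R A}|%:R != 0 :> C.
  by rewrite pnatr_eq0 -lt0n; apply/card_gt0P; exists 0.
exists (fun v : V => #|{: dual R A}|%:R^-1 *
  \sum_b (v.2 b)^-1 * ent M (v.1 + b) b).
apply: operator_ext => a b; rewrite summxE.
under eq_bigr do rewrite mxE ent_weyl.
rewrite -(pair_bigA _ (fun (x : A) (chi : dual R A) => #|{: dual R A}|%:R^-1 *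
  (\sum_c (chi c)^-1 * ent M (x + c) c) *
  (if a == x + b then chi b else 0))) /=.
rewrite (bigD1 (a - b)) //= [X in _ + X]big1 => [|x xab]; last first.
  apply: big1 => chi _; rewrite -subr_eq eq_sym (negPf xab).
  by rewrite mulr0.
rewrite addr0 subrK eqxx.
under eq_bigr do rewrite -mulrA mulr_suml.
rewrite -mulr_sumr exchange_big /= (bigD1 b) //= [X in _ + X]big1 => [|c cb].
  rewrite addr0 subrK.
  under eq_bigr do rewrite mulrAC mulVf ?dual_neq0 // mul1r.
  by rewrite sumr_const; apply: (mulfI card0); rewrite mulVKf // mulr_natl.
under eq_bigr do rewrite mulrAC mulrC.
rewrite -mulr_sumr
  (@sum_hom_eq0 R (dual R A) (fun chi => (chi c)^-1 * chi b)) ?mulr0 //.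
  by move=> chi psi; rewrite !ffunE invfM mulrACA.
have [|chi chi1] := @dual_separates (b - c); first by rewrite subr_eq0 eq_sym.
exists chi; apply: contra chi1 => /eqP chibc; apply/eqP.
apply: (mulIf (dual_neq0 chi c)); rewrite -dualD subrK mul1r.
by rewrite -[RHS]mulr1 -chibc mulVKf ?dual_neq0.
Qed.

End Separation.

(** * Lifting symplectic automorphisms *)

Section Lifting.
Variables (R : realType) (A : finZmodType).
Local Notation C := R[i].
Local Notation V := (phase_space R A).
Local Notation weyl := (@weyl R A).

(** U u_v U^-1 = l(v) u_(Tv), written so as to make sense for any matrix U. *)
Definition intertwines (U : operator R A) (T : V -> V) (l : V -> C) : Prop :=
  forall v, U *m weyl v = l v *: (weyl (T v) *m U).

(** Weyl operators with pairwise trivial omega commute, hence are diagonal in a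
    common basis. *)
Lemma isotropic_eigenvector (I : finZmodType) (f : I -> V) :
  (forall i j, omega (f i) (f j) = 1) ->
  exists2 x : 'cV[C]_#|A|, x != 0 &
    exists mu : I -> C, forall i, weyl (f i) *m x = mu i *: x.
Proof.
move=> iso_f.
have [||P Pu [d dP]] := @commuting_unitary_diag R[i] #|A| I (weyl \o f).
- by move=> i; apply: weyl_unitary.
- by move=> i j; rewrite /comm_mx /= weyl_commute iso_f scale1r.
pose k : 'I_#|A| := enum_rank 0; exists (col k P); first exact: unit_col_neq0.
by exists (fun i => d i 0 k) => i; apply: diag_col_eigen (dP i).
Qed.

Section SymplecticLift.
Variable T : {additive V -> V}.
Hypothesis spT : symplectic T.

Let X (a : A) : V := T (a, 0).
Let Z (chi : dual R A) : V := T (0, chi).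

Let XD a b : X (a + b) = X a + X b.
Proof. by rewrite -raddfD; congr (T _); congr pair; rewrite addr0. Qed.

Let TXZ v : T v = X v.1 + Z v.2.
Proof.
rewrite -raddfD; congr (T _); case: v => a chi.
by congr pair; rewrite ?addr0 ?add0r.
Qed.

Let omegaX a b : omega (X a) (X b) = 1.
Proof. by rewrite spT.2 /omega /beta /= !ffunE invr1 mulr1. Qed.

Let omegaZ chi psi : omega (Z chi) (Z psi) = 1.
Proof. by rewrite spT.2 /omega /beta /= !dual0 invr1 mulr1. Qed.

Let omegaZX chi a : omega (Z chi) (X a) = chi a.
Proof. by rewrite spT.2 /omega /beta /= ffunE invr1 mulr1. Qed.

(** U sends |a> to u_(X a) psi, up to a phase. Since omega(Z chi, X a) = chi(a),
    this vector is an eigenvector of u_(Z chi) for the eigenvalue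
    mu(chi) chi(a), so that different a give orthogonal vectors. *)
Lemma symplectic_lift : exists U l, U \is unitarymx /\ intertwines U T l.
Proof.
have [psi0 psi0_neq0 [mu psi0_mu]] := isotropic_eigenvector omegaZ.
have [phi phi_neq0 [rho phi_rho]] := isotropic_eigenvector omegaX.
have mu_norm chi : `|mu chi| = 1.
  exact: unitary_eigenvalue_norm (weyl_unitary _) psi0_neq0 (psi0_mu chi).
have rho_norm a : `|rho a| = 1.
  exact: unitary_eigenvalue_norm (weyl_unitary _) phi_neq0 (phi_rho a).
have mu_neq0 chi : mu chi != 0 by rewrite -normr_eq0 mu_norm oner_eq0.
have rho_neq0 a : rho a != 0 by rewrite -normr_eq0 rho_norm oner_eq0.
(* rho trivializes beta on the image of X, so 1 / rho is the right phase. *)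
have rhoM a b : rho a * rho b = beta (X a) (X b) * rho (a + b).
  have := congr1 (fun M => M *m phi) (weylM (X a) (X b)).
  rewrite -mulmxA phi_rho -scalemxAr phi_rho scalerA -scalemxAl -XD phi_rho.
  rewrite scalerA mulrC => /eqP; rewrite -subr_eq0 -scalerBl scaler_eq0.
  by rewrite (negPf phi_neq0) orbF subr_eq0 => /eqP.
have [psi psi_mu psi_unit] : exists2 psi : 'cV[C]_#|A|,
    forall chi, weyl (Z chi) *m psi = mu chi *: psi & cdot psi psi = 1.
  exists ((sqrtC (cdot psi0 psi0))^-1 *: psi0) => [chi|].
    by rewrite -scalemxAr psi0_mu !scalerA mulrC.
  have psi0_gt0 := cdot_gt0 psi0_neq0.
  rewrite cdotZ mulrC -normCKC normfV ger0_norm ?sqrtC_ge0 ?ltW //.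
  by rewrite exprVn sqrtCK mulfV ?gt_eqF.
(* The image under U of the basis vector |a>. *)
pose u a := (rho a)^-1 *: (weyl (X a) *m psi).
pose U : operator R A := \matrix_(i, j) u (enum_val j) i 0.
pose l (v : V) := beta (X v.1) (Z v.2) / (rho v.1 * mu v.2).
have weyl_u v a : weyl (T v) *m u a = (l v)^-1 *: (v.2 a *: u (v.1 + a)).
  have -> : weyl (T v) =
      (beta (X v.1) (Z v.2))^-1 *: (weyl (X v.1) *m weyl (Z v.2)).
    by rewrite weylM scalerA mulVf ?beta_neq0 // scale1r -TXZ.
  rewrite /u -scalemxAr -!scalemxAl -!mulmxA [weyl (Z _) *m _]mulmxA.
  rewrite weyl_commute omegaZX -!scalemxAl -!mulmxA psi_mu -!scalemxAr.
  rewrite mulmxA weylM -XD -scalemxAl !scalerA; congr (_ *: _).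
  have -> : (rho (v.1 + a))^-1 = beta (X v.1) (X a) / (rho v.1 * rho a).
    by rewrite rhoM invfM mulrA mulfV ?beta_neq0 // mul1r.
  rewrite /l !invfM !invrK.
  by field; rewrite ?rho_neq0 ?beta_neq0.
have l_neq0 v : l v != 0.
  by rewrite mulf_neq0 ?invr_neq0 ?mulf_neq0 // beta_neq0.
exists U, l; split.
  rewrite -trmxC_unitary; apply/unitarymxP/operator_ext=> a b.
  rewrite trmxCK ent_one.
  have -> : ent (U^t* *m U) a b = cdot (u a) (u b).
    by rewrite /cdot !mxE; apply: eq_bigr => i _; rewrite !mxE !enum_rankK.
  have [->|ab] := eqVneq a b.
    rewrite cdotZ cdot_unitary ?weyl_unitary // psi_unit mulr1.
    by rewrite -normCKC normfV rho_norm invr1 expr1n.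
  (* Eigenvectors of a unitary for different eigenvalues are orthogonal. *)
  have [|chi chi_ab] := @dual_separates R A (b - a).
    by rewrite subr_eq0 eq_sym.
  have uZ c : weyl (T (0, chi)) *m u c = (mu chi * chi c) *: u c.
    rewrite -scalemxAr mulmxA weyl_commute omegaZX -scalemxAl -mulmxA psi_mu.
    by rewrite -scalemxAr !scalerA mulrC mulrAC mulrA.
  have := cdot_unitary (u a) (u b) (weyl_unitary (T (0, chi))).
  rewrite !uZ cdotZ rmorphM mulrACA -normCKC mu_norm expr1n mul1r => ab_eq.
  have {ab_eq} : (chi (b - a) - 1) * cdot (u a) (u b) = 0.
    rewrite mulrBl mul1r -[in X in _ - X]ab_eq -mulrBl.
    have -> : chi b = chi (b - a) * chi a by rewrite -dualD subrK.
    rewrite mulrCA -normCKC dual_norm.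
    by rewrite expr1n mulr1 subrr mul0r.
  by move/eqP; rewrite mulf_eq0 subr_eq0 (negPf chi_ab) => /eqP.
move=> v; apply: operator_ext => a b.
have -> : ent (U *m weyl v) a b = v.2 b * u (v.1 + b) (enum_rank a) 0.
  rewrite ent_mul (bigD1 (v.1 + b)) //= big1 ?addr0 => [|c].
    by rewrite ent_weyl eqxx mxE enum_rankK mulrC.
  by rewrite ent_weyl => /negPf ->; rewrite mulr0.
have -> : ent (l v *: (weyl (T v) *m U)) a b =
    (l v *: (weyl (T v) *m u b)) (enum_rank a) 0.
  have <- : col (enum_rank b) U = u b.
    by apply/colP=> i; rewrite 2!mxE enum_rankK.
  by rewrite [in RHS]colE mulmxA -colE [LHS]mxE [RHS]mxE [in RHS]mxE.
by rewrite weyl_u scalerA mulfV // scale1r [RHS]mxE.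
Qed.

End SymplecticLift.
End Lifting.

(** * The normalizer of the Heisenberg group *)

Section Normalizer.
Variables (R : realType) (A : finZmodType).
Local Notation C := R[i].
Local Notation V := (phase_space R A).
Local Notation weyl := (@weyl R A).

Lemma card_operator_gt0 : (0 < #|{: A}|)%N.
Proof. by apply/card_gt0P; exists 0. Qed.

Lemma intertwines_neq0 (U : operator R A) T l v :
  U \in unitmx -> intertwines U T l -> l v != 0.
Proof.
move=> uU UT; apply: contraTneq uU => lv0; have := UT v.
rewrite lv0 scale0r => UW0; have U0 : U = 0.
  by rewrite -[U](mulmxK (weyl_unit v)) UW0 mul0mx.
by rewrite U0 -row_free_unit /row_free mxrank0 eq_sym -lt0n card_operator_gt0.
Qed.

Lemma intertwines_norm (U : operator R A) T l v :
  U \is unitarymx -> intertwines U T l -> `|l v| = 1.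
Proof.
move=> uU UT; apply: (unitary_scale_norm card_operator_gt0).
  exact: mul_unitarymx (weyl_unitary (T v)) uU.
by rewrite -UT mul_unitarymx ?weyl_unitary.
Qed.

(** Two ways of moving U through u_v u_w. Additivity of T and the relation
    between l and beta are both read off from this equation. *)
Lemma intertwines_mul (U : operator R A) T l v w :
  U \in unitmx -> intertwines U T l ->
  (l v * l w * beta (T v) (T w)) *: weyl (T v + T w) =
  (beta v w * l (v + w)) *: weyl (T (v + w)).
Proof.
move=> uU UT; apply: (can_inj (mulmxK uU)).
transitivity (U *m (weyl v *m weyl w)); last first.
  by rewrite weylM -scalemxAr UT scalerA -scalemxAl.
rewrite mulmxA UT -scalemxAl.
by rewrite -mulmxA UT -scalemxAr mulmxA weylM -!scalemxAl !scalerA !mulrA.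
Qed.

Lemma intertwines_additive (U : operator R A) T l v w :
  U \in unitmx -> intertwines U T l -> T (v + w) = T v + T w.
Proof.
move=> uU UT; have := intertwines_mul v w uU UT.
have c0 : beta v w * l (v + w) != 0.
  by rewrite mulf_neq0 ?(intertwines_neq0 _ uU UT) ?beta_neq0.
move/esym/(canRL (scalerK c0)); rewrite scalerA.
exact: weyl_proportional.
Qed.

Lemma intertwines_cocycle (U : operator R A) T l v w :
  U \in unitmx -> intertwines U T l ->
  l v * l w * beta (T v) (T w) = beta v w * l (v + w).
Proof.
move=> uU UT; have := intertwines_mul v w uU UT.
rewrite -(intertwines_additive _ _ uU UT) => /eqP.
rewrite -subr_eq0 -scalerBl scaler_eq0 (negPf (weyl_neq0 _)) orbF subr_eq0.
by move/eqP.
Qed.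

(** The cocycle relation for (v, w) and (w, v), divided by each other, compares
    the two values of omega. *)
Lemma intertwines_symplectic (U : operator R A) (T : {additive V -> V}) l :
  U \in unitmx -> intertwines U T l -> symplectic T.
Proof.
move=> uU UT; split.
  apply: injF_bij; apply: raddf_inj => v Tv0.
  have := UT v; rewrite Tv0 weyl0 mul1mx -{2}[U]mulmx1 -weyl0 scalemxAr.
  by move/(can_inj (mulKmx uU))/weyl_proportional.
move=> v w; have lvw := intertwines_cocycle v w uU UT.
have lwv := intertwines_cocycle w v uU UT.
have lnz := mulf_neq0 (intertwines_neq0 v uU UT) (intertwines_neq0 w uU UT).
apply: (mulIf (beta_neq0 (T w) (T v))); rewrite -omega_swap; apply: (mulfI lnz).
rewrite lvw mulrCA [l v * _]mulrC lwv addrC mulrA; congr (_ * _).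
exact: omega_swap.
Qed.

Lemma intertwiner_normalizer (U : operator R A) T l :
  U \is unitarymx -> bijective T -> intertwines U T l ->
  heisenberg_normalizer U.
Proof.
move=> uU [T' TK T'K] UT; have u := unitarymx_unit uU; split => //.
have lnz v : l v != 0 := intertwines_neq0 v u UT.
have conjW (z : C) v : U *m (z *: weyl v) *m invmx U = (z * l v) *: weyl (T v).
  by rewrite -scalemxAr UT scalerA -scalemxAl mulmxK.
have lnorm v : `|l v| = 1 := intertwines_norm v uU UT.
apply/seteqP; split => [_ /= [_ [z [v [z1 ->]]] <-]|_ [z [v [z1 ->]]]] /=.
  exists (z * l v), (T v); rewrite conjW; split => //.
  by rewrite /U1 /= normrM lnorm mulr1.
exists ((z / l (T' v)) *: weyl (T' v)).
  exists (z / l (T' v)), (T' v); split => //.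
  by rewrite /U1 /= normrM normfV lnorm invr1 mulr1.
by rewrite conjW T'K mulfVK.
Qed.

Lemma normalizer_intertwines (U : operator R A) : heisenberg_normalizer U ->
  exists (T : {additive V -> V}) l, symplectic T /\ intertwines U T l.
Proof.
move=> [uU normU]; have u := unitarymx_unit uU.
have /choice[f fP] v : exists zw : C * V,
    U *m weyl v = zw.1 *: (weyl zw.2 *m U).
  have : heisenberg_group (U *m weyl v *m invmx U).
    rewrite -normU; exists (weyl v) => //.
    by exists 1, v; rewrite scale1r; split => //; apply: normr1.
  case=> z [w [_ UW]]; exists (z, w) => /=.
  by rewrite -[LHS](mulmxKV u) UW scalemxAl.
pose T v := (f v).2; pose l v := (f v).1.
have UT : intertwines U T l by move=> v; apply: fP.
have Tadd : zmod_morphism T.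
  have TD v w := intertwines_additive v w u UT.
  by move=> v w; rewrite -[in RHS](subrK w v) [in RHS]TD addrK.
pose Ta : {additive V -> V} := HB.pack_for {additive V -> V} T
  (GRing.isZmodMorphism.Build V V T Tadd).
exists Ta, l; split => //; exact: (@intertwines_symplectic U Ta l).
Qed.

Lemma weyl_intertwines w : intertwines (weyl w) id (omega w).
Proof. by move=> v; rewrite weyl_commute. Qed.

End Normalizer.

(** * Products over pairs of indices *)

Section QuadraticSum.
Variables (F : fieldType) (G : zmodType) (b : G -> G -> F) (q : G -> F).
Hypothesis bD : forall x y z, b x (y + z) = b x y * b x z.
Hypothesis b0 : forall x, b x 0 = 1.
Hypothesis qD : forall x y, q (x + y) = q x * q y * b x y.
Hypothesis q0 : q 0 = 1.

Lemma quadratic_sum n (v : 'I_n -> G) :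
  q (\sum_i v i) = \prod_i q (v i) *
    \prod_(i < n) \prod_(j < n | (i < j)%N) b (v i) (v j).
Proof.
elim: n v => [|n IHn] v; first by rewrite !big_ord0 mulr1.
have b_sum x (w : 'I_n -> G) : b x (\sum_i w i) = \prod_i b x (w i).
  elim/big_rec2: _ => [|i y _ _ <-]; [exact: b0 | exact: bD].
have -> : \prod_(i < n.+1) \prod_(j < n.+1 | (i < j)%N) b (v i) (v j) =
    (\prod_(i < n) b (v ord0) (v (lift ord0 i))) * \prod_(i < n)
      \prod_(j < n | (i < j)%N) b (v (lift ord0 i)) (v (lift ord0 j)).
  rewrite big_ord_recl big_mkcond big_ord_recl /= mul1r; congr (_ * _).
  by apply: eq_bigr => i _; rewrite big_mkcond big_ord_recl /= mul1r -big_mkcond.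
rewrite !big_ord_recl qD IHn b_sum -!mulrA; do 2!congr (_ * _).
exact: mulrC.
Qed.

End QuadraticSum.

Lemma prod_trichotomy (F : comPzRingType) n (f : 'I_n -> 'I_n -> F) :
  \prod_i \prod_j f i j = (\prod_i f i i) *
    (\prod_(i < n) \prod_(j < n | (i < j)%N) f i j) *
    (\prod_(i < n) \prod_(j < n | (i < j)%N) f j i).
Proof.
rewrite [X in _ = _ * X](exchange_big_dep predT) //= -!big_split /=.
apply: eq_bigr => i _; rewrite (bigD1 i) //= -mulrA; congr (_ * _).
rewrite (bigID (fun j : 'I_n => (i < j)%N)) /=; congr (_ * _); apply: eq_bigl => j.
  case: ltngtP => [ij|ij|/val_inj ->]; rewrite ?andbT ?andbF //.
  by rewrite -(inj_eq val_inj) gtn_eqF.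
case: ltngtP => [ij|ij|/val_inj ->]; rewrite ?andbT ?andbF ?eqxx //.
by rewrite -(inj_eq val_inj) ltn_eqF.
Qed.

(** * Tensor products of operators *)

Lemma ffun_neq (I : finType) (T : eqType) (f g : {ffun I -> T}) :
  f != g -> exists i, f i != g i.
Proof.
move=> fg; apply/existsP; apply: contraNT fg => /existsPn eq_fg.
by apply/eqP/ffunP=> i; have := eq_fg i; rewrite negbK => /eqP.
Qed.

Section Tensor.
Variables (R : realType) (A : finZmodType) (t : nat).
Local Notation C := R[i].
Local Notation V := (phase_space R A).
Local Notation weyl := (@weyl R A).
Local Notation tensor := (@tensor_op R A t).
Implicit Types M N : 'I_t -> operator R A.

Lemma ent_tensor M (a b : {ffun 'I_t -> A}) :
  ent (tensor M) a b = \prod_k ent (M k) (a k) (b k).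
Proof. by rewrite mxE !enum_rankK. Qed.

Lemma eq_tensor M N : M =1 N -> tensor M = tensor N.
Proof. by move=> eqMN; congr tensor_op; apply/funext. Qed.

Lemma tensorM M N : tensor M *m tensor N = tensor (fun k => M k *m N k).
Proof.
apply: operator_ext => a b; rewrite ent_mul ent_tensor.
under [RHS]eq_bigr do rewrite ent_mul.
rewrite bigA_distr_bigA; apply: eq_bigr => c _.
by rewrite !ent_tensor -big_split.
Qed.

Lemma tensorZ (z : 'I_t -> C) M :
  tensor (fun k => z k *: M k) = (\prod_k z k) *: tensor M.
Proof.
apply: operator_ext => a b; rewrite [RHS]mxE !ent_tensor -big_split.
by apply: eq_bigr => k _; rewrite mxE.
Qed.

Lemma tensor1 : tensor (fun=> 1%:M) = 1%:M.
Proof.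
apply: operator_ext => a b; rewrite ent_tensor ent_one.
have [->|] := eqVneq a b; first by rewrite big1 // => k _; rewrite ent_one eqxx.
case/ffun_neq=> k abk; by rewrite (bigD1 k) //= ent_one (negPf abk) mul0r.
Qed.

Lemma tensor_unit M : (forall k, M k \in unitmx) -> tensor M \in unitmx.
Proof.
move=> uM.
suff /mulmx1_unit[] : tensor M *m tensor (fun k => invmx (M k)) = 1%:M by [].
by rewrite tensorM -tensor1; apply: eq_tensor => k; rewrite mulmxV.
Qed.

Lemma tensor_trace M : \tr (tensor M) = \prod_k \tr (M k).
Proof.
rewrite /mxtrace; under [RHS]eq_bigr do rewrite sum_enum_rank.
rewrite bigA_distr_bigA sum_enum_rank; apply: eq_bigr => a _.
by rewrite ent_tensor.
Qed.

Lemma tensor_sum (J : finType) (F : 'I_t -> J -> operator R A) :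
  tensor (fun k => \sum_j F k j) =
  \sum_(f : {ffun 'I_t -> J}) tensor (fun k => F k (f k)).
Proof.
apply: operator_ext => a b; rewrite ent_tensor summxE.
under eq_bigr do rewrite summxE.
rewrite bigA_distr_bigA; apply: eq_bigr => f _.
by rewrite ent_tensor.
Qed.

Definition weyl_family (f : {ffun 'I_t -> V}) := tensor (fun k => weyl (f k)).

(** An elementary matrix on the tensor power is the tensor product of elementary
    matrices, each of which is a combination of Weyl operators. *)
Lemma weyl_family_span (X : operator R {ffun 'I_t -> A}) :
  exists c : {ffun 'I_t -> V} -> C, X = \sum_f c f *: weyl_family f.
Proof.
pose spanned (Y : operator R {ffun 'I_t -> A}) :=
  exists c, Y = \sum_f c f *: weyl_family f.
have span0 : spanned 0.
  by exists (fun=> 0); rewrite big1 // => f _; rewrite scale0r.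
have spanD Y Y' : spanned Y -> spanned Y' -> spanned (Y + Y').
  move=> [c ->] [c' ->]; exists (fun f => c f + c' f).
  by rewrite -big_split; apply: eq_bigr => f _; rewrite scalerDl.
have spanZ z Y : spanned Y -> spanned (z *: Y).
  move=> [c ->]; exists (fun f => z * c f).
  by rewrite scaler_sumr; apply: eq_bigr => f _; rewrite scalerA.
rewrite [X]matrix_sum_delta -/(spanned _).
apply: big_ind => // i _; apply: big_ind => // j _; apply: spanZ.
pose a : {ffun 'I_t -> A} := enum_val i.
pose b : {ffun 'I_t -> A} := enum_val j.
have -> : delta_mx i j =
    tensor (fun k => delta_mx (enum_rank (a k)) (enum_rank (b k))).
  apply: operator_ext => x y; rewrite ent_tensor mxE.
  rewrite -(enum_valK i) -(enum_valK j) !(inj_eq enum_rank_inj) -/a -/b.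
  have [->|] := eqVneq x a; have [->|] := eqVneq y b => /=.
  - by rewrite big1 // => k _; rewrite mxE !eqxx.
  - case/ffun_neq=> k ybk.
    by rewrite (bigD1 k) //= mxE !(inj_eq enum_rank_inj) (negPf ybk) andbF mul0r.
  - case/ffun_neq=> k xak.
    by rewrite (bigD1 k) //= mxE !(inj_eq enum_rank_inj) (negPf xak) mul0r.
  - move=> _ /ffun_neq[k xak].
    by rewrite (bigD1 k) //= mxE !(inj_eq enum_rank_inj) (negPf xak) mul0r.
have /choice[c cP] k := weyl_span
  (delta_mx (enum_rank (a k)) (enum_rank (b k)) : operator R A).
exists (fun f : {ffun 'I_t -> V} => \prod_k c k (f k)).
rewrite (eq_tensor cP) tensor_sum; apply: eq_bigr => f _.
by rewrite tensorZ.
Qed.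

End Tensor.

(** * The twisted group algebra as an algebra of operators *)

Section Realization.
Variables (R : realType) (A : finZmodType) (t : nat).
Local Notation C := R[i].
Local Notation V := (phase_space R A).
Local Notation weyl := (@weyl R A).
Local Notation tensor := (@tensor_op R A t).
Local Notation Z := (zero_tuple R A t).
Local Notation op := (operator R {ffun 'I_t -> A}).
Local Notation tw := (twisted_group_algebra (alpha_bichar R A t)).
Implicit Types v w : Z.

Lemma kappa_neq0 v : kappa v != 0.
Proof.
by apply/prodf_neq0 => i _; apply/prodf_neq0 => j _; apply: beta_neq0.
Qed.

Lemma kappa0 : kappa (0 : Z) = 1.
Proof.
rewrite /kappa big1 // => i _; rewrite big1 // => j _.
by rewrite !ffunE beta0r.
Qed.

Lemma zero_tuple_sum v : \sum_i v i = 0.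
Proof. exact/eqP/(valP v). Qed.

Lemma weyl_tupleM v w : weyl_tuple v *m weyl_tuple w =
  (\prod_i beta (v i) (w i)) *: weyl_tuple (v + w).
Proof.
rewrite tensorM -tensorZ; apply: eq_tensor => i.
by rewrite weylM ffunE.
Qed.

Lemma kappaD v w : kappa (v + w) = kappa v * kappa w *
  ((\prod_(i < t) \prod_(j < t | (i < j)%N) beta (v i) (w j)) *
   (\prod_(i < t) \prod_(j < t | (i < j)%N) beta (w i) (v j))).
Proof.
rewrite -!big_split; apply: eq_bigr => i _ /=.
rewrite -!big_split; apply: eq_bigr => j _ /=.
by rewrite !ffunE !betaDl !betaDr; ring.
Qed.

(** By bilinearity beta(v_i, w_1 + .. + w_t) = 1. *)
Lemma diagonal_beta v w : (\prod_i beta (v i) (w i)) *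
    (\prod_(i < t) \prod_(j < t | (i < j)%N) beta (v i) (w j)) *
    (\prod_(i < t) \prod_(j < t | (i < j)%N) beta (v j) (w i)) = 1.
Proof.
rewrite -prod_trichotomy big1 // => i _.
rewrite -[RHS](beta0r (v i)) -(zero_tuple_sum w).
elim/big_rec2: _ => [|j x y _ ->]; first by rewrite beta0r.
by rewrite betaDr.
Qed.

Lemma weyl_tildeM v w :
  weyl_tilde v *m weyl_tilde w = alpha v w *: weyl_tilde (v + w).
Proof.
rewrite -scalemxAl -scalemxAr weyl_tupleM !scalerA kappaD; congr (_ *: _).
have -> : alpha v w =
    (\prod_(i < t) \prod_(j < t | (i < j)%N) beta (w i) (v j)) *
    (\prod_(i < t) \prod_(j < t | (i < j)%N) beta (v j) (w i))^-1.
  rewrite -prodfV -big_split; apply: eq_bigr => i _ /=.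
  by rewrite -prodfV -big_split.
have := diagonal_beta v w.
set D := \prod_i _; set X := \prod_(i < t) _; set Y := \prod_(i < t) _.
set W := \prod_(i < t) _ => DXY.
have W0 : W != 0.
  by apply/prodf_neq0 => i _; apply/prodf_neq0 => j _; apply: beta_neq0.
have [D0 X0 Y0] : [/\ D != 0, X != 0 & Y != 0].
  by have := oner_neq0 C; rewrite -DXY !mulf_eq0 !negb_or => /andP[/andP[]].
have -> : D = (X * Y)^-1.
  by apply: (mulIf (mulf_neq0 X0 Y0)); rewrite mulVf ?mulf_neq0 // mulrA.
by field; rewrite X0 Y0 W0 !kappa_neq0.
Qed.

Lemma weyl_tilde_trace v :
  \tr (weyl_tilde v) = if v == 0 then (#|A| ^ t)%:R else 0.
Proof.
rewrite mxtraceZ tensor_trace; case: eqP => [->|/eqP v0].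
  rewrite kappa0 invr1 mul1r; under eq_bigr do rewrite weyl_trace ffunE eqxx.
  by rewrite prodr_const card_ord natrX.
have [|i vi0] := @ffun_neq _ _ (val v) 0; first by rewrite -val_eqE in v0.
rewrite (bigD1 i) //= weyl_trace; rewrite ffunE in vi0.
by rewrite (negPf vi0) mul0r mulr0.
Qed.

Definition realize (x : tw) : op := \sum_v x v *: weyl_tilde v.

Lemma realize_linear : linear realize.
Proof.
move=> a x y; rewrite /realize scaler_sumr -big_split.
by apply: eq_bigr => v _; rewrite tw_addE tw_scaleE scalerDl [in RHS]scalerA.
Qed.

HB.instance Definition _ := GRing.isLinear.Build C tw op *:%R realize realize_linear.

Lemma realize_basis v : realize (tw_basis (alpha_bichar R A t) v) = weyl_tilde v.
Proof.
rewrite /realize (bigD1 v) //= big1 ?addr0 => [|w wv].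
  by rewrite tw_basisE eqxx scale1r.
by rewrite tw_basisE (negPf wv) scale0r.
Qed.

Lemma weyl_tilde0 : weyl_tilde (0 : Z) = 1%:M.
Proof.
rewrite /weyl_tilde kappa0 invr1 scale1r -tensor1; apply: eq_tensor => k.
by rewrite ffunE weyl0.
Qed.

Lemma realize1 : realize 1 = 1%:M.
Proof. by rewrite [1]/(tw_basis _ 0) realize_basis weyl_tilde0. Qed.

Lemma realizeM (x y : tw) : realize (x * y) = realize x *m realize y.
Proof.
rewrite {1}[x]tw_basis_sum {1}[y]tw_basis_sum mulr_suml linear_sum /= mulmx_suml.
apply: eq_bigr => v _; rewrite !mulr_sumr linear_sum mulmx_sumr.
apply: eq_bigr => w _ /=.
rewrite tw_scaleMM tw_basisM scalerA linearZ /= realize_basis.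
by rewrite -scalemxAl -scalemxAr weyl_tildeM [in RHS]scalerA [in RHS]scalerA.
Qed.

(** The trace of realize x *m u~_(-w) is a nonzero multiple of x w. *)
Lemma realize_inj : injective realize.
Proof.
apply: raddf_inj => x x0; apply/ffunP=> w; rewrite ffunE.
have := congr1 (fun M => \tr (M *m weyl_tilde (- w))) x0.
rewrite mul0mx mxtrace0 mulmx_suml linear_sum (bigD1 w) //= big1 ?addr0 => [|v vw].
  rewrite -scalemxAl weyl_tildeM subrr 2!mxtraceZ weyl_tilde_trace eqxx.
  move/eqP; rewrite !mulf_eq0 pnatr_eq0 expn_eq0 -[#|A| == _](pnatr_eq0 C).
  rewrite (negPf (cardA_neq0 R A)) /=.
  by rewrite (negPf (bichar_neq0 (alpha_bichar R A t) _ _)) !orbF => /eqP.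
rewrite -scalemxAl weyl_tildeM 2!mxtraceZ weyl_tilde_trace subr_eq0 (negPf vw).
by rewrite !mulr0.
Qed.

(** U^(x)t multiplies u_v by the product of the l(v_i), which by
    [quadratic_sum] is l(0) kappa(v) / kappa(Tv): the normalization of u~ is
    the one for which no scalar is left. *)
Lemma tensor_weyl_tilde (U : operator R A) (T : {additive V -> V}) l v :
  U \in unitmx -> intertwines U T l ->
  tensor (fun=> U) *m weyl_tilde v = weyl_tilde (sp_act T v) *m tensor (fun=> U).
Proof.
move=> uU UT; rewrite -scalemxAr -scalemxAl !tensorM.
rewrite (@eq_tensor _ _ _ _ (fun i => l (v i) *: (weyl (T (v i)) *m U))) //.
rewrite tensorZ scalerA; congr (_ *: _); last first.
  by apply: eq_tensor => i; rewrite ffunE.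
have l00 : l 0 = 1.
  have := intertwines_cocycle 0 0 uU UT.
  rewrite raddf0 beta0r mulr1 mul1r addr0.
  move/(canRL (mulfK (intertwines_neq0 0 uU UT))) => ->.
  by rewrite mulfV // (intertwines_neq0 0 uU UT).
pose b (x y : V) := beta (T x) (T y) / beta x y.
have := @quadratic_sum C V b l _ _ _ l00 t v.
rewrite zero_tuple_sum l00.
have -> : \prod_(i < t) \prod_(j < t | (i < j)%N) b (v i) (v j) =
    kappa (sp_act T v) / kappa v.
  rewrite -prodfV -big_split; apply: eq_bigr => i _ /=.
  rewrite -prodfV -big_split; apply: eq_bigr => j _ /=.
  by rewrite !ffunE.
move=> quad; apply: (mulIf (kappa_neq0 (sp_act T v))).
rewrite mulVf ?kappa_neq0 // -mulrA mulrC -mulrA; apply/esym/quad.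
- move=> x y z; rewrite /b raddfD !betaDr /= invfM.
  by rewrite mulrACA.
- by move=> x; rewrite /b raddf0 !beta0r divr1.
- move=> x y; rewrite /b mulrA (intertwines_cocycle x y uU UT).
  by rewrite mulrAC mulfV ?beta_neq0 // mul1r.
Qed.

Lemma realize_act (U : operator R A) (T : {additive V -> V}) l x :
  U \in unitmx -> intertwines U T l ->
  tensor (fun=> U) *m realize x = realize (sp_act_alg T x) *m tensor (fun=> U).
Proof.
move=> uU UT; rewrite {1}/realize mulmx_sumr.
rewrite /sp_act_alg [realize _]linear_sum mulmx_suml.
apply: eq_bigr => v _ /=; rewrite [realize _]linearZ /= realize_basis.
by rewrite -scalemxAr (tensor_weyl_tilde _ uU UT) -[in RHS]scalemxAl.
Qed.

Lemma realize_commutant (x : tw) :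
  (x \in @invariant_pred R A t) = (realize x \in @commutant_pred R A t).
Proof.
apply/asboolP/asboolP => [inv_x _ [U0 nU0 <-] _ [z _ <-]|com_x T spT].
  have [T [l [spT UT]]] := normalizer_intertwines nU0.
  rewrite tensorZ -scalemxAl -scalemxAr; congr (_ *: _).
  by rewrite (realize_act _ _ UT) ?inv_x // unitarymx_unit //; case: nU0.
have [U [l [uU UT]]] := symplectic_lift spT.
have u := unitarymx_unit uU.
apply: realize_inj.
have uTU : tensor (fun=> U) \in unitmx by apply: tensor_unit.
apply: (can_inj (mulmxK uTU)); rewrite -(realize_act _ u UT).
apply/esym/(com_x [set z *: U | z in @U1 R]%classic).
  by exists U => //; apply: intertwiner_normalizer uU _ UT; case: spT.
by exists 1; rewrite ?scale1r // /U1 /= normr1.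
Qed.

(** X equals its average over conjugation by the u_w^(x)t, w in V. Conjugation
    multiplies the term of X at f by omega(w, f_1 + .. + f_t), whose average is
    1 or 0 according as f has sum zero or not. *)
Lemma commutant_realize (X : op) : X \in @commutant_pred R A t ->
  exists x, X = realize x.
Proof.
move=> /asboolP comX; have [c defX] := weyl_family_span X.
pose W (w : V) := tensor (fun=> weyl w).
have uW (w : V) : W w \in unitmx by apply: tensor_unit => k; apply: weyl_unit.
have XW (w : V) : X = W w *m X *m invmx (W w).
  have cliff_w : clifford_group [set z *: weyl w | z in @U1 R]%classic.
    exists (weyl w) => //; apply: intertwiner_normalizer (weyl_intertwines w).
      exact: weyl_unitary.
    by exists id.
  rewrite -(comX _ cliff_w (weyl w)) ?mulmxK ?uW //.
  by exists 1; rewrite ?scale1r // /U1 /= normr1.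
have conjW (w : V) f : W w *m weyl_family f *m invmx (W w) =
    omega w (\sum_i f i) *: weyl_family f.
  have -> : omega w (\sum_i f i) = \prod_i omega w (f i).
    by elim/big_rec2: _ => [|i y x _ <-]; [exact: omega0r|exact: omegaDr].
  apply: (canLR (mulmxK (uW w))).
  rewrite tensorM -scalemxAl tensorM -tensorZ; apply: eq_tensor => i.
  exact: weyl_commute.
have V0 : #|{: V}|%:R != 0 :> C.
  by rewrite pnatr_eq0 -lt0n; apply/card_gt0P; exists 0.
have defX0 : X = \sum_(f | f \in @zero_sum R A t) c f *: weyl_family f.
  apply: (scalerI V0).
  transitivity (\sum_(w : V) \sum_f
      (c f * omega w (\sum_i f i)) *: weyl_family f).
    rewrite scaler_nat -sumr_const; apply: eq_bigr => w _.
    rewrite (XW w) defX mulmx_sumr mulmx_suml; apply: eq_bigr => f _.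
    by rewrite -scalemxAr -scalemxAl conjW scalerA.
  rewrite exchange_big /= (bigID (fun f => f \in @zero_sum R A t)) /=.
  rewrite [X in _ + X]big1 ?addr0 => [|f f0].
    rewrite scaler_sumr; apply: eq_bigr => f /eqP f0.
    transitivity (\sum_(w : V) c f *: weyl_family f).
      apply: eq_bigr => w _.
      by rewrite f0 omega0r mulr1.
    by rewrite sumr_const scaler_nat.
  rewrite -scaler_suml -mulr_sumr (@sum_hom_eq0 R V (fun y : V => omega y _)).
    by rewrite mulr0 scale0r.
    by move=> x y; apply: omegaDl.
  exact: omega_nondegenerate.
exists ([ffun v : Z => c (val v) * kappa v] : tw).
rewrite defX0 /realize (reindex_omap (val : Z -> _) insub) /=; last first.
  by move=> f f0; rewrite insubT.
apply: eq_big => [v|v _]; first by rewrite valK eqxx andbT (valP v).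
by rewrite ffunE scalerA mulfK ?kappa_neq0.
Qed.

End Realization.

Lemma commutant_iso_invariants (R : realType) (A : finZmodType) (t : nat) :
  algebra_isomorphic (commutant R A t) (invariants R A t).
Proof.
have /choice[f fP] (X : commutant R A t) :
    exists x : invariants R A t, realize (invariants_val x) = commutant_val X.
  have [x defX] := commutant_realize (valP X).
  have x_inv : x \in @invariant_pred R A t.
    by rewrite realize_commutant -defX (valP X).
  by exists (Invariants x_inv).
have /choice[h hP] (x : invariants R A t) :
    exists X : commutant R A t, commutant_val X = realize (invariants_val x).
  have x_com : realize (invariants_val x) \in @commutant_pred R A t.
    by rewrite -realize_commutant (valP x).
  by exists (Commutant x_com).
have realize_val_inj (x y : invariants R A t) :
  realize (invariants_val x) = realize (invariants_val y) -> x = y.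
  by move/realize_inj/val_inj.
have f_lin : linear f.
  move=> a X Y; apply: realize_val_inj.
  have -> : invariants_val (a *: f X + f Y) =
    a *: invariants_val (f X) + invariants_val (f Y) by [].
  by rewrite fP [RHS]linearP /= !fP.
have f_mul : monoid_morphism f.
  split=> [|X Y]; apply: realize_val_inj; rewrite fP.
    have -> : invariants_val (1 : invariants R A t) = 1 by [].
    by rewrite realize1.
  have -> : invariants_val (f X * f Y) =
    invariants_val (f X) * invariants_val (f Y) by [].
  by rewrite realizeM !fP.
pose F : {lrmorphism commutant R A t -> invariants R A t} :=
  HB.pack_for {lrmorphism commutant R A t -> invariants R A t} f
    (GRing.isLinear.Build _ _ _ _ f f_lin)
    (GRing.isMonoidMorphism.Build _ _ f f_mul).
exists F, h => [X|x]; first by apply/val_inj/(etrans (hP _) (fP _)).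
by apply: realize_val_inj; apply: etrans (fP _) (hP _).
Qed.

Unset Implicit Arguments.
Set Strict Implicit.

Theorem proposition5p3 (R : realType) (A : finZmodType) (t : nat)
    (ht : (1 <= t)%N) :
  [/\ forall v w : zero_tuple R A t,
        weyl_tilde v *m weyl_tilde w = alpha v w *: weyl_tilde (v + w),
      bicharacter (@alpha R A t),
      forall T : {additive phase_space R A -> phase_space R A},
        symplectic T -> forall v w : zero_tuple R A t,
          alpha (sp_act T v) (sp_act T w) = alpha v w
    & algebra_isomorphic (commutant R A t) (invariants R A t)].
Proof.
split.
- exact: weyl_tildeM.
- exact: alpha_bicharacter.
- by move=> T spT v w; apply: alpha_invariant.
- exact: commutant_iso_invariants.
Qed.
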